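(* Let $\Delta$ be the discriminant of a quadratic field, $D=|\Delta|$, and let $P_\Delta$ be the generalized Paley graph attached to $\chi_\Delta$. Then the spectrum of $P_\Delta$ (the multiset of eigenvalues, with multiplicity, of its $D\times D$ adjacency matrix) is the union (as multisets, multiplicities being added) of the multisets \[ \left[\frac{1}{2}\,\frac{\varphi(D)}{\varphi(d)}\,\mu(d)\right]_{\varphi(d)} \quad\text{for each positive divisor } d\mid D \text{ with } d<D, \] together with \[ \left[\frac{1}{2}\left(\sqrt{\Delta}+\mu(D)\right)\right]_{\frac{\varphi(D)}{2}} \quad\text{and}\quad \left[\frac{1}{2}\left(-\sqrt{\Delta}+\mu(D)\right)\right]_{\frac{\varphi(D)}{2}}. \]
   Context: Let $m\neq 1$ be a squarefree integer and let $\Delta$ be the discriminant of the quadratic field $\mathbb{Q}(\sqrt{m})$: $\Delta=m$ if $m\equiv 1\pmod 4$, and $\Delta=4m$ if $m\equiv 2,3\pmod 4$. Put $D=|\Delta|$. The function $\chi_\Delta(a)=\left(\frac{\Delta}{a}\right)$ (Kronecker symbol, $a\in\mathbb{Z}$) is the associated primitive quadratic Dirichlet character of conductor $D$; it is periodic mod $D$ and vanishes when $\gcd(a,D)>1$. The generalized Paley graph $P_\Delta$ has vertex set $\{0,1,\dots,D-1\}$, with an edge from $u$ to $v$ if and only if $\chi_\Delta(v-u)=1$. It is undirected if $\Delta>0$ and directed if $\Delta<0$. Here $\varphi$ is Euler's totient function and $\mu$ is the Möbius function. The notation $[a]_b$ denotes the multiset consisting of $a$ repeated $b$ times. When $\Delta<0$,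 $\sqrt{\Delta}=i\sqrt{|\Delta|}$. *)

(* Defs.v *)
From HB Require Import structures.
From mathcomp Require Import all_boot all_order all_algebra.
From mathcomp Require Import finmap multiset.

Set Implicit Arguments.
Unset Strict Implicit.
Unset Printing Implicit Defensive.

Import Order.TTheory GRing.Theory Num.Theory.
Local Open Scope ring_scope.

(* This excludes m = 0, since 2 ^+ 2 divides 0. *)
Definition squarefreez (m : int) : Prop :=
  forall k : int, (k ^+ 2 %| m)%Z -> k \is a GRing.unit.

Definition quad_disc (m : int) : int :=
  if (m %% 4)%Z == 1 then m else 4 * m.

Definition mobius (n : nat) : int :=
  if (0 < n)%N && all (fun p => logn p n == 1)%N (primes n)
  then (-1) ^+ size (primes n) else 0.

Definition legendre (n : int) (p : nat) : int :=
  if (p %| n)%Z then 0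
  else if [exists x : 'I_p, (((x : nat)%:Z ^+ 2 == n %[mod p])%Z)] then 1
  else -1.

Definition kronecker2 (n : int) : int :=
  if (2 %| n)%Z then 0
  else if ((n %% 8)%Z == 1) || ((n %% 8)%Z == 7) then 1 else -1.

Definition kronecker_prime (n : int) (p : nat) : int :=
  if p == 2 then kronecker2 n else legendre n p.

(* (n / a) is completely multiplicative in a, with (n / -1) = -1 iff n < 0 and
   (n / 0) = 1 if n = 1 or n = -1, and 0 otherwise. *)
Definition kronecker (n a : int) : int :=
  if a == 0 then (if (`|n| == 1)%N then 1 else 0)
  else (if (a < 0) && (n < 0) then -1 else 1) *
       \prod_(p <- primes `|a|%N) kronecker_prime n p ^+ logn p `|a|%N.

Definition paley (Delta : int) : rel 'I_(`|Delta|%N) :=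
  fun u v => kronecker Delta ((v : nat)%:Z - (u : nat)%:Z) == 1.

Definition adjmx (R : pzRingType) (n : nat) (e : rel 'I_n) : 'M[R]_n :=
  \matrix_(u, v) (e u v)%:R.

(* Eigenvalues with algebraic multiplicity: [closed_field_poly_normal] provides
   the list of roots of the (monic, split) characteristic polynomial. *)
Definition spectrum (C : numClosedFieldType) (n : nat) (A : 'M[C]_n) :
    {mset C}%mset :=
  seq_mset (sval (closed_field_poly_normal (char_poly A))).

Definition sqrtz (C : numClosedFieldType) (x : int) : C :=
  if 0 <= x then sqrtC x%:~R else 'i * sqrtC `|x|%:~R.

(* Main.v *)
Require Import Defs.
From HB Require Import structures.
From mathcomp Require Import all_boot all_order all_algebra all_solvable all_field.
From mathcomp Require Import finmap multiset.
From mathcomp Require Import zify ring.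

(** The adjacency matrix of the graph is circulant, so that the discrete Fourier
transform diagonalizes it, with eigenvalues [sum_(chi(a) = 1) z^(k a)], where
[z] is a primitive [D]-th root of unity and [k < D].  As
[2 * [chi(a) = 1] = chi(a) + [gcd(a, D) = 1]], twice this eigenvalue is a Gauss
sum plus a Ramanujan sum.  The Gauss sum is [chi(k) G] with [G^2 = Delta], and
the Ramanujan sum is [phi(D)/phi(d) mu(d)] with [d = D / gcd(k, D)]; the sign of
[G] does not matter because [chi] takes the values [1] and [-1] equally often.

This needs the Kronecker symbol to be a primitive character modulo [D], which is
a form of quadratic reciprocity.  A primitive real character [psi] modulo [D]
with [psi(-1) D = Delta] is built as a product of Legendre symbols and of
characters modulo 4 or 8.  Its Gauss sum [G] satisfies [G^q = psi(q) G] modulo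
an odd prime [q], and Euler's criterion yields [(Delta/q) = psi(q)].  For [q = 2]
and [D] odd, the same argument is applied to the algebraic integer
[(G + mu(D)) / 2], whose integrality also gives [Delta = 1] modulo 4. *)

Set Implicit Arguments.
Unset Strict Implicit.
Unset Printing Implicit Defensive.

Import Order.TTheory GRing.Theory Num.Theory.
Local Open Scope ring_scope.

(** * Primitive real characters and Gauss sums *)

Section PeriodicSums.

Variable N : nat.
Hypothesis N_gt0 : (0 < N)%N.

(** The integer residue already lies in [[0, N)]; the second, natural-number reduction only supplies
    the bound that ['I_N] asks for. *)
Definition modz_ord (a : int) : 'I_N := Ordinal (ltn_pmod `|(a %% N)%Z| N_gt0).

Lemma modz_ordE (a : int) : (modz_ord a : nat)%:Z = (a %% N)%Z.
Proof.
have N0 : N%:Z != 0 by rewrite eqz_nat -lt0n.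
have a_ge0 := modz_ge0 a N0.
rewrite /= modn_small ?gez0_abs // -ltz_nat gez0_abs //.
by rewrite ltz_mod.
Qed.

Lemma ord_eq_mod (i j : 'I_N) : (i%:Z = j %[mod N])%Z -> i = j.
Proof.
by rewrite !modz_nat !modn_small // => -[?]; apply: val_inj.
Qed.

(** An injection of the finite set of residues into itself is a permutation. It is applied to
    multiplication by a unit and to translation. *)
Lemma sum_mod_reindex (V : nmodType) (f g : int -> V) (h : int -> int) :
    (forall a b, (a = b %[mod N])%Z -> f a = f b) ->
    (forall a b, (h a = h b %[mod N])%Z -> (a = b %[mod N])%Z) ->
    (forall a, g a = f (h a)) ->
  \sum_(a < N) g a = \sum_(a < N) f a.
Proof.
move=> f_mod h_inj gE.
have inj : injective (fun i : 'I_N => modz_ord (h i)).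
  move=> i j /(congr1 (fun k : 'I_N => k%:Z)); rewrite /= !modz_ordE.
  by move/h_inj/ord_eq_mod.
rewrite [RHS](reindex_inj inj); apply: eq_bigr => i _; rewrite gE; apply: f_mod.
by rewrite modz_ordE modz_mod.
Qed.

Lemma coprimez_mulIm (c a b : int) :
  coprimez c N -> (c * a = c * b %[mod N])%Z -> (a = b %[mod N])%Z.
Proof.
move=> co /eqP; rewrite !eqz_mod_dvd -mulrBr Gauss_dvdzr 1?coprimez_sym //.
by rewrite -eqz_mod_dvd => /eqP.
Qed.

End PeriodicSums.

(* [rpc_prim] expresses primitivity: it makes the Gauss sum at any frequency [k]
   that is not prime to [N] equal to its opposite. *)
Record real_primitive_char (N : nat) (psi : int -> int) : Prop := {
  rpc_gt0 : (0 < N)%N;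
  rpc_mod : forall a b, (a = b %[mod N])%Z -> psi a = psi b;
  rpcM : forall a b, psi (a * b) = psi a * psi b;
  rpc_sqr : forall a, psi a ^+ 2 = (coprimez a N)%:R;
  rpc_prim : forall k, ~~ coprimez k N ->
    exists2 c, psi c = -1 & (c * k = k %[mod N])%Z }.

Section RealPrimitiveChar.

Variables (N : nat) (psi : int -> int).
Hypothesis psiP : real_primitive_char N psi.
Let N_gt0 := rpc_gt0 psiP.

Lemma rpc0 a : ~~ coprimez a N -> psi a = 0.
Proof.
by move=> co; apply/eqP; rewrite -sqrf_eq0 (rpc_sqr psiP) (negPf co).
Qed.

Variant rpc_spec (a : int) : int -> bool -> Type :=
 | RpcOne of psi a = 1 : rpc_spec a 1 true
 | RpcNeg of psi a = -1 : rpc_spec a (-1) true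
 | RpcZero of psi a = 0 : rpc_spec a 0 false.

Lemma rpcP a : rpc_spec a (psi a) (coprimez a N).
Proof.
case: (boolP (coprimez a N)) => [co|/rpc0 e]; last by rewrite e; constructor.
case: (boolP (psi a == 1)) => /eqP e1; first by rewrite e1; constructor.
case: (boolP (psi a == -1)) => /eqP e2; first by rewrite e2; constructor.
by exfalso; move/eqP: (rpc_sqr psiP a); rewrite co sqrf_eq1 => /orP[]/eqP.
Qed.

Lemma rpc1 : psi 1 = 1.
Proof.
have co1 : coprimez 1 N by rewrite /coprimez /gcdz gcd1n.
have := rpcM psiP 1 1; have := rpc_sqr psiP 1.
by rewrite mul1r co1 expr2 => e1 e2; rewrite e2 e1.
Qed.

Lemma rpcN1 : psi (-1) = 1 \/ psi (-1) = -1.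
Proof.
have co1 : coprimez (-1) N by rewrite /coprimez /gcdz gcd1n.
by move/eqP: (rpc_sqr psiP (-1)); rewrite co1 sqrf_eq1 => /orP[]/eqP; [left | right].
Qed.

Lemma rpc_coprime_neq0 a : psi a != 0 -> coprimez a N.
Proof. by case: rpcP. Qed.

End RealPrimitiveChar.

Section PrimitiveRootPowers.

Variables (F : numFieldType) (N : nat) (z : F).
Hypothesis z_prim : N.-primitive_root z.
Let N_gt0 := prim_order_gt0 z_prim.

Lemma prim_root_neq0 : z != 0.
Proof. by rewrite (prim_root_eq0 z_prim) -lt0n. Qed.

Lemma expz_prim_mod (a b : int) : (a = b %[mod N])%Z -> z ^ a = z ^ b.
Proof.
suff H c : z ^ c = z ^ (c %% N)%Z by move=> e; rewrite H e -H.
rewrite {1}(divz_eq c N) expfzDr ?prim_root_neq0 // [_ * N%:Z]mulrC -exprz_exp.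
by rewrite -[z ^ N]/(z ^+ N) (prim_expr_order z_prim) exp1rz mul1r.
Qed.

Lemma sum_expz_prim (k : int) :
  \sum_(a < N) z ^ (k * a%:Z) = if (N %| k)%Z then N%:R else 0.
Proof.
case: ifPn => [/dvdzP[q ->]|ndvd].
  rewrite (eq_bigr (fun=> 1)) ?sumr_const ?card_ord // => a _.
  rewrite -(expr0z z); apply: expz_prim_mod.
  by rewrite mod0z mulrAC modzMl.
have zk_neq1 : z ^ k != 1.
  apply: contraNN ndvd; rewrite {1}(divz_eq k N) => /eqP e.
  have : z ^ (k %% N)%Z = 1.
    by rewrite -e -divz_eq; apply: expz_prim_mod; rewrite modz_mod.
  have := modz_ge0 k (_ : N%:Z != 0); rewrite eqz_nat -lt0n => /(_ N_gt0).
  case E: (k %% N)%Z => [n|//] _ /eqP.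
  rewrite -[z ^ _]/(z ^+ n) -(prim_order_dvd z_prim) => dvd.
  apply/dvdz_mod0P; rewrite E; case: n E dvd => // n E /(dvdn_leq (ltn0Sn n)).
  have : (k %% N < N)%Z by rewrite ltz_pmod.
  by rewrite E ltz_nat ltnNge => /negPf ->.
(* Multiplying by [z ^ k - 1] telescopes the geometric sum to [z ^ (k * N) - 1 = 0]. *)
apply: (mulfI (_ : z ^ k - 1 != 0)); first by rewrite subr_eq0.
have -> : \sum_(a < N) z ^ (k * a%:Z) = \sum_(a < N) (z ^ k) ^+ a.
  by apply: eq_bigr => a _; rewrite -exprz_exp.
rewrite -subrX1 mulr0 -[_ ^+ N]/((z ^ k) ^ N) exprz_exp.
rewrite (expz_prim_mod (_ : _ = 0 %[mod _])%Z) ?subrr //.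
by rewrite modzMl mod0z.
Qed.

End PrimitiveRootPowers.

Section GaussSum.

Variables (F : numFieldType) (N : nat) (psi : int -> int) (z : F).
Hypothesis psiP : real_primitive_char N psi.
Hypothesis z_prim : N.-primitive_root z.
Let N_gt0 := rpc_gt0 psiP.

Definition gauss_sum (k : int) : F := \sum_(a < N) (psi a)%:~R * z ^ (k * a%:Z).

Lemma gauss_sum_mull (c k : int) :
  coprimez c N -> gauss_sum k = (psi c)%:~R * gauss_sum (c * k).
Proof.
move=> co.
rewrite /gauss_sum mulr_sumr.
rewrite -(@sum_mod_reindex _ N_gt0 _ (fun a => (psi a)%:~R * z ^ (k * a))
   (fun a => (psi c)%:~R * ((psi a)%:~R * z ^ (c * k * a))) ( *%R c)) //.
- move=> a b e; congr (_%:~R * _); first exact: (rpc_mod psiP).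
  by apply: (expz_prim_mod z_prim); rewrite -modzMmr e modzMmr.
- by move=> a b; apply: coprimez_mulIm.
by move=> a; rewrite (rpcM psiP) intrM mulrA [k * _]mulrCA mulrA.
Qed.

(** For [k] prime to [N], reindex by multiplication by [k]; otherwise the [c] of [rpc_prim] fixes
    [k] modulo [N] and the sum is its own opposite. *)
Lemma gauss_sumE (k : int) : gauss_sum k = (psi k)%:~R * gauss_sum 1.
Proof.
case: (boolP (coprimez k N)) => [co|nco].
  rewrite (gauss_sum_mull 1 co) mulr1 mulrA -intrM -expr2 (rpc_sqr psiP) co.
  by rewrite mul1r.
rewrite (rpc0 psiP nco) mul0r.
have [c ec ek] := rpc_prim psiP nco.
have co : coprimez c N by apply: (rpc_coprime_neq0 psiP); rewrite ec.
have : gauss_sum (c * k) = gauss_sum k.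
  apply: eq_bigr => a _; congr (_ * _); apply: (expz_prim_mod z_prim).
  by rewrite -modzMml ek modzMml.
move=> e; move: (gauss_sum_mull k co); rewrite e ec mulN1r => /eqP.
by rewrite -addr_eq0 -mulr2n mulrn_eq0 /= => /eqP.
Qed.

(** Absorb each [psi b] of one factor into the Gauss sum at frequency [b], then exchange the sums:
    the inner sum over [b] vanishes unless [a = -1] modulo [N]. *)
Lemma gauss_sum_sqr : gauss_sum 1 ^+ 2 = (psi (-1) * N%:Z)%:~R.
Proof.
transitivity (\sum_(b < N) \sum_(a < N) (psi a)%:~R * z ^ ((a%:Z + 1) * b%:Z)).
  rewrite expr2 {1}/gauss_sum mulr_suml; apply: eq_bigr => b _.
  rewrite mulrAC -gauss_sumE /gauss_sum mulr_suml; apply: eq_bigr => a _.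
  rewrite -mulrA -expfzDr ?(prim_root_neq0 z_prim) //; congr (_ * z ^ _).
  by rewrite mul1r mulrDl mul1r mulrC.
rewrite exchange_big /=.
under eq_bigr => a _ do rewrite -mulr_sumr (sum_expz_prim z_prim).
rewrite (bigD1 (modz_ord N_gt0 (-1))) //= (modz_ordE N_gt0).
rewrite big1 => [|i ne]; last first.
  case: ifPn => dvd; last by rewrite mulr0.
  case/negP: ne; apply/eqP/ord_eq_mod; rewrite (modz_ordE N_gt0) modz_mod.
  by apply/eqP; rewrite eqz_mod_dvd opprK.
have -> : (N %| (-1 %% N)%Z + 1)%Z.
  by apply/dvdz_mod0P; rewrite modzDml addNr mod0z.
rewrite addr0 intrM; congr (_%:~R * _); apply: (rpc_mod psiP).
by rewrite modz_mod.
Qed.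

End GaussSum.

(** * Ramanujan sums *)

Lemma mobius1 : mobius 1 = 1.
Proof. by []. Qed.

Lemma mobius_dvd_sqr (p d : nat) : prime p -> (p ^ 2 %| d)%N -> mobius d = 0.
Proof.
move=> p_pr dvd; rewrite /mobius; case: ifP => // /andP[d_gt0 /allP sf].
have p_d : p \in primes d.
  by rewrite mem_primes p_pr d_gt0 (dvdn_trans _ dvd) // dvdn_exp.
by move: dvd; rewrite pfactor_dvdn // (eqP (sf p p_d)).
Qed.

Lemma mobius_mul_prime (p d : nat) :
  prime p -> (0 < d)%N -> ~~ (p %| d)%N -> mobius (p * d) = - mobius d.
Proof.
move=> p_pr d_gt0 ndvd; have p_gt0 := prime_gt0 p_pr.
have pNd : p \notin primes d by rewrite mem_primes p_pr d_gt0.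
have pe : perm_eq (primes (p * d)) (p :: primes d).
  apply: uniq_perm; rewrite ?primes_uniq //=; first by rewrite pNd primes_uniq.
  by move=> q; rewrite primesM // primes_prime // !inE.
rewrite /mobius muln_gt0 p_gt0 d_gt0 (perm_all _ pe) (perm_size pe) /=.
rewrite lognM // logn_prime // eqxx lognE p_pr d_gt0 (negPf ndvd) /=.
have -> : all (fun q => logn q (p * d) == 1)%N (primes d)
        = all (fun q => logn q d == 1)%N (primes d).
  apply: eq_in_all => q qd; rewrite lognM // logn_prime //.
  by have [e|//] := eqVneq q p; rewrite e (negPf pNd) in qd.
by case: ifP; rewrite ?oppr0 // exprS mulN1r.
Qed.

Lemma sum_ord_blocks (V : nmodType) (p M : nat) (f : nat -> V) :
  \sum_(a < p * M) f a = \sum_(j < p) \sum_(b < M) f (j * M + b)%N.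
Proof.
elim: p => [|p IH]; first by rewrite !big_ord0.
by rewrite mulSnr big_split_ord /= IH big_ord_recr.
Qed.

Section RamanujanSum.

Variable F : numFieldType.

Definition ramanujan_sum (N : nat) (w : F) : F :=
  \sum_(a < N) (coprime a N)%:R * w ^+ a.

(** With [a = j * M + b], coprimality to [M] depends on [b] alone, so a geometric sum in [w ^+ M], a
    [p]-th root of unity, factors out. *)
Let coprime_sum_blocks (p M : nat) (w : F) : w ^+ (p * M) = 1 ->
  \sum_(a < p * M) (coprime a M)%:R * w ^+ a =
    if w ^+ M == 1 then p%:R * ramanujan_sum M w else 0.
Proof.
move=> w1; rewrite (sum_ord_blocks _ _ (fun a => (coprime a M)%:R * w ^+ a)).
transitivity ((\sum_(j < p) (w ^+ M) ^+ j) * ramanujan_sum M w).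
  rewrite mulr_suml; apply: eq_bigr => j _; rewrite mulr_sumr.
  apply: eq_bigr => b _; rewrite exprD mulnC exprM mulrCA.
  by rewrite /coprime -gcdn_modl mulnC modnMDl gcdn_modl.
case: eqP => [->|/eqP ne].
  by under eq_bigr do rewrite expr1n; rewrite sumr_const card_ord.
suff -> : \sum_(j < p) (w ^+ M) ^+ j = 0 by rewrite mul0r.
apply: (mulfI (_ : w ^+ M - 1 != 0)); first by rewrite subr_eq0.
by rewrite -subrX1 -exprM mulnC w1 subrr mulr0.
Qed.

Let sum_multiples (p M : nat) (w : F) : prime p -> ~~ (p %| M)%N ->
  \sum_(a < p * M) ((p %| a)%N && coprime a M)%:R * w ^+ a =
    ramanujan_sum M (w ^+ p).
Proof.
move=> p_pr ndvd; rewrite mulnC.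
rewrite (sum_ord_blocks _ _ (fun a => ((p %| a)%N && coprime a M)%:R * w ^+ a)).
apply: eq_bigr => j _.
rewrite (bigD1 (Ordinal (prime_gt0 p_pr))) //= big1 => [|b b0]; last first.
  rewrite dvdn_addr ?dvdn_mull // gtnNdvd ?mul0r ?lt0n //.
rewrite addn0 addr0 dvdn_mull // mulnC exprM.
by rewrite coprimeMl prime_coprime // ndvd.
Qed.

(* Hoelder's formula, by removing the prime factors of [N] one at a time, so that
   no surjectivity of the reduction from units mod [N] to units mod [d] is needed. *)
Lemma ramanujan_sumE (N d : nat) (w : F) :
    (0 < N)%N -> d.-primitive_root w -> (d %| N)%N ->
  ramanujan_sum N w = (totient N)%:R / (totient d)%:R * (mobius d)%:~R.
Proof.
elim/ltn_ind: N d w => N IH d w N_gt0 w_prim d_dvd.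
have tot_neq0 n : (0 < n)%N -> (totient n)%:R != 0 :> F.
  by move=> n_gt0; rewrite pnatr_eq0 -lt0n totient_gt0.
have d_gt0 := prim_order_gt0 w_prim.
have [N_le1|N_gt1] := leqP N 1.
  have N1 : N = 1%N by apply/eqP; rewrite eqn_leq N_le1.
  have d1 : d = 1%N by apply/eqP; rewrite -dvdn1 -N1.
  by rewrite N1 d1 /ramanujan_sum big_ord1 divrr ?unitr1 // mobius1 !mulr1.
pose p := pdiv N; have p_pr : prime p by apply: pdiv_prime.
have p_gt0 := prime_gt0 p_pr.
have [M NE] : exists M, N = (p * M)%N.
  by case/dvdnP: (pdiv_dvd N) => M ->; exists M; rewrite mulnC.
clearbody p; subst N.
have M_gt0 : (0 < M)%N by move: N_gt0; rewrite muln_gt0 => /andP[].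
have M_lt : (M < p * M)%N by rewrite ltn_Pmull ?prime_gt1.
have wpM : w ^+ (p * M) = 1 by apply/eqP; rewrite -(prim_order_dvd w_prim).
have [pM|pNM] := boolP (p %| M)%N.
  have totE : totient (p * M) = (p * totient M)%N.
    have [m' pm' ->] := pfactor_coprime p_pr M_gt0.
    have e_gt0 : (0 < logn p M)%N by rewrite -pfactor_dvdn.
    rewrite mulnCA -expnS !totient_coprime 1?coprime_sym ?coprimeXl //.
    rewrite !totient_pfactor //= -{1}(prednK e_gt0) expnS.
    by rewrite [RHS]mulnCA; congr (_ * _)%N; rewrite mulnCA.
  have copE (a : nat) : coprime a (p * M) = coprime a M.
    rewrite coprimeMr; case: (boolP (coprime a M)) => [co|]; last by rewrite andbF.
    by rewrite andbT (coprime_dvdr pM co).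
  rewrite /ramanujan_sum; under eq_bigr do rewrite copE.
  rewrite coprime_sum_blocks // -(prim_order_dvd w_prim).
  case: ifPn => [dM|dNM]; first by rewrite (IH M M_lt d) // totE natrM !mulrA.
  (* Here [p ^ 2] divides [d]: otherwise [p] divides [d] at most once, and since [p] divides [M],
     [d] would divide [M]. *)
  rewrite (mobius_dvd_sqr p_pr) ?mulr0 //.
  apply: contraNT dNM => np2.
  have [/dvdnP[e dE]|pd] := boolP (p %| d)%N; last first.
    by move: d_dvd; rewrite Gauss_dvdr // coprime_sym prime_coprime.
  move: np2 d_dvd; rewrite dE -mulnn dvdn_pmul2r // => pe.
  rewrite mulnC dvdn_pmul2l // => eM.
  by rewrite Gauss_dvd ?pM // prime_coprime.
have totE : totient (p * M) = (p.-1 * totient M)%N.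
  by rewrite totient_coprime ?prime_coprime // totient_prime.
have pE : p%:R = p.-1%:R + 1 :> F by rewrite -{1}(prednK p_gt0) -natr1.
(* Being prime to [p * M] means being prime to [M] without being a multiple of [p]. *)
transitivity (\sum_(a < p * M) (coprime a M)%:R * w ^+ a - ramanujan_sum M (w ^+ p)).
  rewrite -sum_multiples // -sumrB; apply: eq_bigr => a _.
  rewrite -mulrBl; congr (_ * _).
  rewrite coprimeMr (coprime_sym a p) prime_coprime //.
  by case: (p %| a)%N; case: coprime; rewrite /= ?subrr ?subr0.
rewrite coprime_sum_blocks // -(prim_order_dvd w_prim).
(* If [d] divides [M], then [w ^+ p] still has order [d], and the two terms combine into [p - 1]
   copies of one Ramanujan sum. *)
case: ifPn => [dM|dNM].
  have copd : coprime p d.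
    by rewrite prime_coprime //; apply: contra pNM => /dvdn_trans; apply.
  rewrite (IH M M_lt d w) // (IH M M_lt d (w ^+ p)) ?prim_root_exp_coprime //.
  by rewrite totE natrM pE; ring.
(* Otherwise the first sum vanishes and [w ^+ p] has order [e = d / p]; the minus sign is that of
   [mobius (p * e)]. *)
have [e dE] : exists e, d = (p * e)%N.
  suff /dvdnP[e ->] : (p %| d)%N by exists e; rewrite mulnC.
  apply: contraNT dNM => pd.
  by move: d_dvd; rewrite Gauss_dvdr // coprime_sym prime_coprime.
subst d.
have eM : (e %| M)%N by move: d_dvd; rewrite dvdn_pmul2l.
have pNe : ~~ (p %| e)%N by apply: contra pNM => /dvdn_trans; apply.
have e_gt0 := dvdn_gt0 M_gt0 eM.
have wp_prim : e.-primitive_root (w ^+ p).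
  have := exp_prim_root w_prim p.
  by rewrite (gcdn_idPl _) ?dvdn_mulr // mulKn.
rewrite (IH M M_lt e (w ^+ p)) // mobius_mul_prime // totE.
rewrite totient_coprime ?prime_coprime // (totient_prime p_pr) !natrM intrN sub0r.
have p1_neq0 : p.-1%:R != 0 :> F.
  by rewrite pnatr_eq0 -lt0n -ltnS prednK // prime_gt1.
by field; rewrite p1_neq0 tot_neq0.
Qed.

End RamanujanSum.

(** * Legendre symbols *)

Section LegendreSymbol.

Variable p : nat.
Hypothesis p_pr : prime p.
Hypothesis p_odd : odd p.

Let p_gt2 : (2 < p)%N. Proof. exact: odd_prime_gt2. Qed.

Lemma intr_Fp_eq0 (n : int) : (n%:~R == 0 :> 'F_p) = (p %| n)%Z.
Proof. by rewrite (dvdz_pcharf (pchar_Fp p_pr)). Qed.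

Lemma intr_Fp_eq (a b : int) : (a%:~R == b%:~R :> 'F_p) = (a == b %[mod p])%Z.
Proof. by rewrite -subr_eq0 -intrB intr_Fp_eq0 eqz_mod_dvd. Qed.

Lemma legendre_existsE (n : int) :
  [exists x : 'I_p, ((x%:Z ^+ 2 == n %[mod p])%Z)] =
  [exists y : 'F_p, y ^+ 2 == n%:~R].
Proof.
apply/existsP/existsP => -[x /eqP xn].
  by exists x%:R; rewrite -natrX -[_%:R]/(_%:Z%:~R) intr_Fp_eq -xn.
have x_lt : (x < p)%N by rewrite -{2}(Fp_cast p_pr).
exists (Ordinal x_lt); rewrite /= -intr_Fp_eq -xn rmorphXn /=.
by rewrite -[x%:Z%:~R]/(x%:R) natr_Zp.
Qed.

Lemma Fp_prim_root : {g : 'F_p | p.-1.-primitive_root g}.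
Proof.
have p1_gt0 : (0 < p.-1)%N by lia.
have card_nz : size (enum (predC1 (0 : 'F_p))) = p.-1.
  by rewrite -cardE cardC1 card_Fp.
apply/sigW; have /hasP[g _ ?] : has p.-1.-primitive_root (enum (predC1 (0 : 'F_p))).
  apply: has_prim_root => //; rewrite ?enum_uniq ?card_nz //.
  apply/allP=> x; rewrite mem_enum inE => x_neq0; rewrite unity_rootE.
  apply/eqP/(mulfI x_neq0); rewrite mulr1 -exprS prednK ?prime_gt0 //.
  by rewrite -{2}(expf_card x) card_Fp.
by exists g.
Qed.

Lemma Fp_half_power (u : 'F_p) : u != 0 ->
  u ^+ p.-1./2 = if [exists y : 'F_p, y ^+ 2 == u] then 1 else -1.
Proof.
move=> u0; have [g g_prim] := Fp_prim_root.
have pE : p.-1 = (p.-1./2 * 2)%N.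
  by rewrite muln2 -[LHS]odd_double_half -subn1 oddB ?prime_gt0 // p_odd.
have u_pow : u ^+ p.-1 = 1.
  apply: (mulfI u0); rewrite mulr1 -exprS prednK ?prime_gt0 //.
  by rewrite -{2}(expf_card u) card_Fp.
case: existsP => [[y /eqP yu]|nsq].
  rewrite -yu -exprM mulnC -pE; apply: (mulfI (_ : y != 0)).
    by apply: contraNneq u0 => y0; rewrite -yu y0 expr0n.
  by rewrite mulr1 -exprS prednK ?prime_gt0 // -{2}(expf_card y) card_Fp.
have : (u ^+ p.-1./2) ^+ 2 == 1 by rewrite -exprM -pE u_pow.
rewrite sqrf_eq1 => /orP[/eqP u1|/eqP //]; case: nsq.
(* For [u = g ^+ i] with half power 1, [p - 1] divides [i * (p - 1) / 2], so [i] is even and [u] is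
   a square. *)
have [[i i_lt] /= ui] := prim_rootP g_prim u_pow.
move/eqP: u1; rewrite ui -exprM -(prim_order_dvd g_prim) {1}pE mulnC.
have h_gt0 : (0 < p.-1./2)%N by move: p_gt2; case: (p) => [|[|[|]]].
rewrite dvdn_pmul2r // => /dvdnP[j ->].
by exists (g ^+ j); rewrite exprM.
Qed.

Lemma legendre_Euler (n : int) :
  (legendre n p)%:~R = n%:~R ^+ p.-1./2 :> 'F_p.
Proof.
have h_gt0 : (0 < p.-1./2)%N by move: p_gt2; case: (p) => [|[|[|]]].
rewrite /legendre -intr_Fp_eq0; case: ifPn => [/eqP->|n0].
  by rewrite expr0n eqn0Ngt h_gt0.
by rewrite legendre_existsE Fp_half_power //; case: ifP.
Qed.

Lemma legendre_values (n : int) :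
  [\/ legendre n p = 0, legendre n p = 1 | legendre n p = -1].
Proof.
rewrite /legendre; case: ifP => _; first exact: Or31.
by case: ifP => _; [apply: Or32 | apply: Or33].
Qed.

(** Two such values differ by at most 2, and [p > 2]; this lifts congruences between symbols to
    equalities. *)
Lemma sign_eq_mod (a b : int) :
    [\/ a = 0, a = 1 | a = -1] -> [\/ b = 0, b = 1 | b = -1] ->
  (p %| a - b)%Z -> a = b.
Proof.
have le d : (0 < d < 3)%N -> (p %| d)%N -> False.
  by case/andP=> d0 d3 /(dvdn_leq d0) pd; move: d3; rewrite ltnNge (leq_trans _ pd).
by case=> -> [] -> // /le [].
Qed.

Lemma legendreM (a b : int) : legendre (a * b) p = legendre a p * legendre b p.
Proof.
apply: sign_eq_mod; first exact: legendre_values.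
  by case: (legendre_values a) => ->; case: (legendre_values b) => ->;
    [apply: Or31 | apply: Or31 | apply: Or31 | apply: Or31 | apply: Or32
    | apply: Or33 | apply: Or31 | apply: Or33 | apply: Or32].
by rewrite -intr_Fp_eq0 intrB intrM !legendre_Euler intrM exprMn subrr.
Qed.

Lemma coprimez_prime (a : int) : coprimez a p = ~~ (p %| a)%Z.
Proof. by rewrite /coprimez gcdzC -prime_coprime. Qed.

Lemma legendre_char : real_primitive_char p (legendre^~ p).
Proof.
split=> [||a b|a|k]; first exact: prime_gt0.
- move=> a b e; rewrite /legendre -!intr_Fp_eq0 !legendre_existsE.
  suff -> : a%:~R = b%:~R :> 'F_p by [].
  by apply/eqP; rewrite intr_Fp_eq e.
- exact: legendreM.
- rewrite coprimez_prime /legendre; case: ifP => //= _.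
  by case: ifP.
rewrite coprimez_prime negbK => pk.
(* A primitive root is a non-residue, as its order [p - 1] exceeds [(p - 1) / 2]; it fixes [k],
   which is 0 modulo [p]. *)
have [g g_prim] := Fp_prim_root.
have gE : g = (g : nat)%:Z%:~R by rewrite -[RHS]/(g%:R) natr_Zp.
exists (g : nat)%:Z; last first.
  by apply/eqP; rewrite eqz_mod_dvd -{2}[k]mul1r -mulrBl dvdz_mull.
have := legendre_Euler (g : nat)%:Z; rewrite -gE.
have h_gt0 : (0 < p.-1./2)%N by move: p_gt2; case: (p) => [|[|[|]]].
have h_lt : (p.-1./2 < p.-1)%N by lia.
case: (legendre_values (g : nat)%:Z) => -> // /esym/eqP.
  rewrite expf_eq0 => /andP[_]; rewrite (prim_root_eq0 g_prim).
  by move=> /eqP e; rewrite e in h_lt.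
by rewrite -(prim_order_dvd g_prim) => /(dvdn_leq h_gt0); rewrite leqNgt h_lt.
Qed.

End LegendreSymbol.

(** * Construction of primitive characters *)

Lemma coprimez_mod (a b : int) (N : nat) :
  (a = b %[mod N])%Z -> coprimez a N = coprimez b N.
Proof. by rewrite /coprimez => e; rewrite -gcdz_modl e gcdz_modl. Qed.

Lemma real_primitive_charM (N1 N2 : nat) (psi1 psi2 : int -> int) :
    real_primitive_char N1 psi1 -> real_primitive_char N2 psi2 ->
    coprime N1 N2 ->
  real_primitive_char (N1 * N2) (fun a => psi1 a * psi2 a).
Proof.
move=> psi1P psi2P co12; have co12z : coprimez N1 N2 by [].
have modP a b : (a = b %[mod (N1 * N2)%N])%Z <->
    (a = b %[mod N1])%Z /\ (a = b %[mod N2])%Z.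
  rewrite PoszM; split=> [/eqP|[/eqP a1 /eqP a2]].
    by rewrite zchinese_remainder // => /andP[/eqP ? /eqP ?].
  by apply/eqP; rewrite zchinese_remainder // a1.
have copE a : coprimez a (N1 * N2)%N = coprimez a N1 && coprimez a N2.
  by rewrite PoszM coprimezMr.
split=> [|a b /modP[e1 e2]|a b|a|k].
- by rewrite muln_gt0 (rpc_gt0 psi1P) (rpc_gt0 psi2P).
- by rewrite (rpc_mod psi1P e1) (rpc_mod psi2P e2).
- by rewrite (rpcM psi1P) (rpcM psi2P) mulrACA.
- by rewrite exprMn (rpc_sqr psi1P) (rpc_sqr psi2P) copE; do 2!case: coprimez.
rewrite copE negb_and => /orP[/(rpc_prim psi1P)|/(rpc_prim psi2P)] [c c1 ck].
  (* The witness for one factor is extended by 1 modulo the other, where it acts trivially and the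
     character is 1. *)
  pose d := zchinese N1 N2 c 1.
  have d1 : (d = c %[mod N1])%Z by apply: zchinese_modl.
  have d2 : (d = 1 %[mod N2])%Z by apply: zchinese_modr.
  exists d; first by rewrite (rpc_mod psi1P d1) (rpc_mod psi2P d2) c1 (rpc1 psi2P).
  by apply/modP; split; rewrite -modzMml ?d1 ?d2 modzMml ?mul1r.
pose d := zchinese N1 N2 1 c.
have d1 : (d = 1 %[mod N1])%Z by apply: zchinese_modl.
have d2 : (d = c %[mod N2])%Z by apply: zchinese_modr.
exists d; first by rewrite (rpc_mod psi1P d1) (rpc_mod psi2P d2) c1 (rpc1 psi1P).
by apply/modP; split; rewrite -modzMml ?d1 ?d2 modzMml ?mul1r.
Qed.

Definition table_char (N : nat) (s : seq int) (a : int) : int :=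
  nth 0 s `|(a %% N)%Z|.

(** The axioms [rpcM], [rpc_sqr] and [rpc_prim] as a finite computation; [rpc_mod] holds for any
    table. *)
Definition table_check (N : nat) (s : seq int) : bool :=
  [&& all (fun a => all (fun b => nth 0 s ((a * b) %% N)%N == nth 0 s a * nth 0 s b)
          (iota 0 N)) (iota 0 N),
      all (fun a => nth 0 s a ^+ 2 == (coprime a N)%:R) (iota 0 N)
    & all (fun k => coprime k N ||
          has (fun c => (nth 0 s c == -1) && (c * k == k %[mod N])) (iota 0 N))
        (iota 0 N)].

Lemma table_charP (N : nat) (s : seq int) :
  (0 < N)%N -> table_check N s -> real_primitive_char N (table_char N s).
Proof.
move=> N_gt0 /and3P[/allP mulP /allP sqrP /allP primP].
have mod_nat a : exists2 a' : nat, a' \in iota 0 N & (a = a' %[mod N])%Z.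
  exists (modz_ord N_gt0 a); first by rewrite mem_iota add0n ltn_ord.
  by rewrite modz_ordE modz_mod.
have tab_mod a b : (a = b %[mod N])%Z -> table_char N s a = table_char N s b.
  by rewrite /table_char => ->.
have tab_nat (a : nat) : table_char N s a = nth 0 s (a %% N)%N.
  by rewrite /table_char modz_nat.
have tab_iota (a : nat) : a \in iota 0 N -> table_char N s a = nth 0 s a.
  by rewrite mem_iota add0n tab_nat => a_lt; rewrite modn_small.
split=> // [a b|a|k].
- have [a' a'N ea] := mod_nat a; have [b' b'N eb] := mod_nat b.
  rewrite (tab_mod a a') // (tab_mod b b') //.
  rewrite (tab_mod _ (a' * b')%N%:Z); last first.
    by rewrite PoszM -modzMml ea modzMml -modzMmr eb modzMmr.
  by rewrite tab_nat !tab_iota //; apply/eqP; move/allP: (mulP _ a'N); apply.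
- have [a' a'N ea] := mod_nat a.
  rewrite (tab_mod a a') // tab_iota // (coprimez_mod ea).
  by apply/eqP/sqrP.
have [k' k'N ek] := mod_nat k; rewrite (coprimez_mod ek).
move: (primP _ k'N); rewrite -[coprimez k' N]/(coprime k' N).
case: coprime => //= /hasP[c cN /andP[/eqP c1 /eqP ck]] _.
exists c; first by rewrite tab_iota.
by rewrite ek -modzMmr ek modzMmr -PoszM !modz_nat ck.
Qed.

Lemma trivial_char : real_primitive_char 1 (table_char 1 [:: 1]).
Proof. by apply: table_charP. Qed.

(** These three are the characters of discriminants -4, 8 and -8; [chi4] and [chiN8] are odd, [chi8]
    is even. *)
Definition chi4 := table_char 4 [:: 0; 1; 0; -1].
Definition chi8 := table_char 8 [:: 0; 1; 0; -1; 0; -1; 0; 1].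
Definition chiN8 := table_char 8 [:: 0; 1; 0; 1; 0; -1; 0; -1].

Lemma chi4_char : real_primitive_char 4 chi4.
Proof. by apply: table_charP; vm_compute. Qed.

Lemma chi8_char : real_primitive_char 8 chi8.
Proof. by apply: table_charP; vm_compute. Qed.

Lemma chiN8_char : real_primitive_char 8 chiN8.
Proof. by apply: table_charP; vm_compute. Qed.

(** Product of the Legendre symbols at the primes dividing [n], whose moduli are coprime because [n]
    is squarefree. *)
Lemma odd_real_primitive_char (n : nat) :
    odd n -> (forall p, prime p -> ~~ (p ^ 2 %| n)%N) ->
  exists psi, real_primitive_char n psi.
Proof.
elim/ltn_ind: n => n IH n_odd n_sf.
have [n_le1|n_gt1] := leqP n 1.
  have -> : n = 1%N by case: n n_le1 n_odd {IH n_sf} => [|[]].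
  by exists (table_char 1 [:: 1]); apply: trivial_char.
have p_pr := pdiv_prime n_gt1; have pn := pdiv_dvd n.
move: (pdiv n) p_pr pn => p p_pr /dvdnP[m nE].
have m_gt0 : (0 < m)%N by case: m nE => // nE; rewrite nE in n_gt1.
move: n_odd; rewrite nE oddM => /andP[m_odd p_odd].
have [psi psiP] : exists psi, real_primitive_char m psi.
  apply: IH => // [|q q_pr]; first by rewrite nE ltn_Pmulr ?prime_gt1.
  by apply: contra (n_sf q q_pr); rewrite nE; apply: dvdn_mulr.
eexists; apply: (real_primitive_charM psiP (legendre_char p_pr p_odd)).
rewrite coprime_sym prime_coprime //; apply: contra (n_sf p p_pr) => pm.
by rewrite nE -mulnn dvdn_mul.
Qed.

(** * Reciprocity *)

(** The inner binomial coefficients are divisible by [q]. *)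
Lemma Aint_expDn_prime (q : nat) (x y : algC) :
    prime q -> x \in Aint -> y \in Aint ->
  ((x + y) ^+ q == x ^+ q + y ^+ q %[mod q])%A.
Proof.
move=> q_pr xA yA; rewrite exprDn -(prednK (prime_gt0 q_pr)) big_ord_recr /=.
rewrite big_ord_recl /= subn0 subnn !expr0 mulr1 mul1r bin0 binn !mulr1n.
rewrite -[y ^+ _ in X in (_ == X %[mod _])%A]add0r addrA eqAmodDr.
rewrite -[X in (_ == X %[mod _])%A]addr0 -addrA eqAmodDl addr0 eqAmod0.
apply: rpred_sum => i _; rewrite /bump /= add1n.
have /dvdnP[c ->] : (q %| 'C(q.-1.+1, i.+1))%N.
  rewrite prednK ?prime_gt0 //; apply: prime_dvd_bin => //.
  by rewrite /= -ltn_predRL ltn_ord.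
rewrite prednK ?prime_gt0 // mulrnA -[X in X \in _]mulr_natr -eqAmod0.
by apply: eqAmodMl0; rewrite rpredMn // rpredM // rpredX.
Qed.

Lemma Aint_sumX_prime (I : finType) (q : nat) (x : I -> algC) :
    prime q -> (forall i, x i \in Aint) ->
  ((\sum_i x i) ^+ q == \sum_i x i ^+ q %[mod q])%A.
Proof.
move=> q_pr xA.
(* Integrality of the partial sums is carried along, since [Aint_expDn_prime] requires it. *)
pose K (y1 y2 : algC) := y1 \in Aint /\ (y1 ^+ q == y2 %[mod q])%A.
suff [] : K (\sum_i x i) (\sum_i x i ^+ q) by [].
apply: (big_rec2 K) => [|i y1 y2 _ [y2A e]].
  by split; rewrite ?rpred0 // expr0n eqn0Ngt prime_gt0.
split; first exact: rpredD.
apply: eqAmod_trans (Aint_expDn_prime q_pr (xA i) y2A) _.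
by rewrite eqAmodDl.
Qed.

(** The eigenvalue of the graph at frequency [k]. Being a sum of roots of unity, it is visibly an
    algebraic integer although [residue_sumE] expresses it with a denominator 2. *)
Definition residue_sum (F : numFieldType) (N : nat) (psi : int -> int) (z : F)
    (k : int) : F :=
  \sum_(a < N) (psi a%:Z == 1)%:R * z ^ (k * a%:Z).

Lemma residue_sumE (F : numFieldType) (N : nat) (psi : int -> int) (z : F) (k : int) :
    real_primitive_char N psi -> N.-primitive_root z ->
  2 * residue_sum N psi z k =
    (psi k)%:~R * gauss_sum N psi z 1 + ramanujan_sum N (z ^ k).
Proof.
move=> psiP z_prim; rewrite -(gauss_sumE psiP z_prim) -big_split mulr_sumr /=.
apply: eq_bigr => a _.
rewrite -[(z ^ k) ^+ a]/((z ^ k) ^ a%:Z) exprz_exp -mulrDl mulrA; congr (_ * _).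
rewrite -[coprime a N]/(coprimez a N).
by case: (rpcP psiP a); rewrite /= ?mulr1 ?mulr0 ?addr0 // ?addNr // -natrD.
Qed.

Lemma ramanujan_sum_prim (F : numFieldType) (N : nat) (z : F) :
  N.-primitive_root z -> ramanujan_sum N z = (mobius N)%:~R.
Proof.
move=> z_prim; have N_gt0 := prim_order_gt0 z_prim.
rewrite (ramanujan_sumE N_gt0 z_prim) // divff ?mul1r //.
by rewrite pnatr_eq0 -lt0n totient_gt0.
Qed.

(** A rational algebraic integer is an integer, so congruences descend to the integers. *)
Lemma intr_dvdA (q : nat) (a : int) : (a%:~R == 0 %[mod q])%A = (q %| a)%Z.
Proof.
by rewrite eqAmod0_rat ?rpred_nat ?rpred_int // dvdC_int ?rpred_int // intrKfloor.
Qed.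

Section Reciprocity.

Variables (N : nat) (psi : int -> int).
Hypothesis psiP : real_primitive_char N psi.
Let N_gt0 := rpc_gt0 psiP.
Let Delta := psi (-1) * N%:Z.

Lemma rpc_odd_prime (q : nat) : prime q -> odd q -> legendre Delta q = psi q.
Proof.
move=> q_pr q_odd; have [z z_prim] := C_prim_root_exists N_gt0.
have zA := Aint_prim_root z_prim.
have [qD|qND] := boolP (q %| Delta)%Z.
  rewrite /legendre qD (rpc0 psiP) // coprimez_sym coprimez_prime // negbK.
  by move: qD; rewrite /Delta !dvdzE abszM; case: (rpcN1 psiP) => ->; rewrite mul1n.
pose G := gauss_sum N psi z 1.
have GA : G \in Aint.
  by apply: rpred_sum => a _; rewrite rpredM ?Aint_int // mul1r rpredX.
have : (G ^+ q == (psi q)%:~R * G %[mod q])%A.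
  rewrite -(gauss_sumE psiP z_prim); apply: eqAmod_trans (Aint_sumX_prime q_pr _) _.
    by move=> a; rewrite rpredM ?Aint_int // mul1r rpredX.
  rewrite (eq_bigr (fun a : 'I_N => (psi a)%:~R * z ^ (q%:Z * a%:Z))) // => a _.
  rewrite exprMn mul1r -[(z ^ a) ^+ q]/((z ^ a) ^ q%:Z) exprz_exp [a%:Z * _]mulrC.
  congr (_ * _); have q_gt0 := prime_gt0 q_pr.
  case: (rpcP psiP a) => _; rewrite ?expr1n ?expr0n ?eqn0Ngt ?q_gt0 //.
  by rewrite rmorphN1 -signr_odd q_odd.
(* Multiplying by [G] makes both sides integers: [G ^+ q.+1] is [Delta] to the power [(q + 1) / 2],
   and [G ^+ 2 = Delta]. *)
move/(eqAmodMl GA); rewrite mulrCA -expr2 (gauss_sum_sqr psiP z_prim) -exprS.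
have -> : q.+1 = (2 * q.-1./2.+1)%N.
  have hE : q.-1 = q.-1./2.*2.
    by rewrite -[LHS]odd_double_half -subn1 oddB ?prime_gt0 // q_odd.
  by rewrite mul2n doubleS -hE prednK ?prime_gt0.
rewrite exprM (gauss_sum_sqr psiP z_prim) -/Delta -rmorphXn -intrM /=.
rewrite /eqAmod -eqAmod0 -intrB intr_dvdA exprSr -mulrBl => dvd.
apply: (sign_eq_mod q_pr q_odd); first exact: legendre_values.
  by case: (rpcP psiP q) => ?; [apply: Or32 | apply: Or33 | apply: Or31].
(* Cancel [Delta], which is prime to [q], and recognize Euler's criterion. *)
move: dvd; rewrite Gauss_dvdzl ?(coprimez_sym q) ?coprimez_prime //.
by rewrite -!(intr_Fp_eq0 q_pr) !intrB (legendre_Euler q_pr q_odd) rmorphXn.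
Qed.

Hypothesis N_sqfree : mobius N ^+ 2 = 1.

(* With [theta = (G + mu) / 2] the residue sum at frequency 1, the number
   [t = theta^2 - mu theta] is rational and an algebraic integer. *)
Let theta (z : algC) : N.-primitive_root z ->
  exists t : int, [/\ Delta = 4 * t + 1, residue_sum N psi z 1 \in Aint &
    residue_sum N psi z 1 ^+ 2 - (mobius N)%:~R * residue_sum N psi z 1 = t%:~R].
Proof.
move=> z_prim; have zA := Aint_prim_root z_prim.
set th := residue_sum _ _ _ _; set mu := mobius N.
have thA : th \in Aint.
  by apply: rpred_sum => a _; rewrite rpredM ?rpred_nat // mul1r rpredX.
have th2 : 2 * th = gauss_sum N psi z 1 + mu%:~R.
  by rewrite residue_sumE // (rpc1 psiP) mul1r expr1z ramanujan_sum_prim.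
have muA : mu%:~R \in Aint := Aint_int _.
have mu2 : mu%:~R ^+ 2 = 1 :> algC by rewrite -rmorphXn N_sqfree.
(* Completing the square: the left side is [(2 * th - mu) ^+ 2 - mu ^+ 2], with [2 * th - mu] the
   Gauss sum. *)
have th4 : 4 * (th ^+ 2 - mu%:~R * th) = Delta%:~R - 1.
  rewrite -(gauss_sum_sqr psiP z_prim) -[X in _ = _ - X]mu2.
  have -> : gauss_sum N psi z 1 = 2 * th - mu%:~R by rewrite th2 addrK.
  by ring.
have tE : th ^+ 2 - mu%:~R * th = (Delta%:~R - 1) / 4.
  by rewrite -th4 [RHS]mulrC mulKf // pnatr_eq0.
have /intrP[t te] : th ^+ 2 - mu%:~R * th \in Num.int.
  apply: Cint_rat_Aint; last by rewrite rpredB ?rpredM // rpredX.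
  by rewrite tE rpred_div ?rpredB ?rpred_int ?rpred_nat ?rpred1.
exists t; split=> //; apply/(@intr_inj algC).
by rewrite intrD intrM -te th4 subrK.
Qed.

Lemma rpc_sqfree_mod4 : (Delta = 1 %[mod 4])%Z.
Proof.
have [z /theta[t [-> _ _]]] := C_prim_root_exists N_gt0.
by rewrite -modzDml modzMr add0r.
Qed.

(* [theta^2] is congruent modulo 2 to the residue sum at frequency 2, which is
   [theta] or [mu - theta] according to [psi 2]; hence the parity of [t]. *)
Lemma rpc_sqfree_kronecker2 : odd N -> kronecker2 Delta = psi 2.
Proof.
move=> N_odd; have [z z_prim] := C_prim_root_exists N_gt0.
have zA := Aint_prim_root z_prim.
have [t [DE thA te]] := theta z_prim.
have th2 : 2 * residue_sum N psi z 1 = gauss_sum N psi z 1 + (mobius N)%:~R.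
  by rewrite residue_sumE // (rpc1 psiP) mul1r expr1z ramanujan_sum_prim.
have thX2 : (residue_sum N psi z 1 ^+ 2 == residue_sum N psi z 2 %[mod 2%N])%A.
  apply: eqAmod_trans (Aint_sumX_prime _ _) _ => // [a|].
    by rewrite rpredM ?rpred_nat // mul1r rpredX.
  rewrite /residue_sum; set s1 := \sum_a _; set s2 := \sum_a _.
  suff -> : s1 = s2 by [].
  apply: eq_bigr => a _; rewrite exprMn mul1r.
  rewrite -[(z ^ a) ^+ 2]/((z ^ a) ^ 2%:Z) exprz_exp [a%:Z * _]mulrC.
  by case: eqP; rewrite ?expr1n ?expr0n.
have rs2 : 2 * residue_sum N psi z 2 =
    (psi 2)%:~R * gauss_sum N psi z 1 + (mobius N)%:~R.
  rewrite residue_sumE // ramanujan_sum_prim //.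
  by rewrite -[z ^ 2]/(z ^+ 2) prim_root_exp_coprime // coprime2n.
have two_neq0 : 2 != 0 :> algC by rewrite pnatr_eq0.
have muE : mobius N = 1 \/ mobius N = -1.
  by move/eqP: N_sqfree; rewrite sqrf_eq1 => /orP[]/eqP; [left | right].
have halve (x y : algC) : 2 * x = 2 * y -> x = y by apply: mulfI.
(* The bit [e] is the parity of [t], read off after replacing theta squared by the residue sum at
   frequency 2. *)
have par (e : bool) w : w \in Aint ->
    residue_sum N psi z 2 - (mobius N)%:~R * residue_sum N psi z 1 - e%:R = w * 2 ->
    (2 %| t - e%:Z)%Z.
  move=> wA we; rewrite -(intr_dvdA 2) intrB -te.
  apply: (@eqAmod_trans _ (w * 2)); last exact: eqAmodMl0.
  by rewrite -we eqAmodDr eqAmodDr.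
(* [Delta = 4 * t + 1] is 1 or 5 modulo 8 according to the parity of [t]. *)
have DE8 (e : bool) : (2 %| t - e%:Z)%Z -> kronecker2 Delta = (-1) ^+ e.
  case/dvdzP=> s ts; have -> : Delta = s * 8 + (4 * e%:Z + 1).
    by rewrite DE -(subrK e%:Z t) ts; ring.
  rewrite /kronecker2 rpredDl; last exact: dvdz_mull.
  by rewrite modzMDl; case: (e).
have : coprimez 2 N by rewrite -[coprimez 2 N]/(coprime 2 N) coprime2n.
case: (rpcP psiP 2) => // psi2 _; rewrite psi2 in rs2.
  apply: (DE8 false); have rsE : residue_sum N psi z 2 = residue_sum N psi z 1.
    by apply: halve; rewrite rs2 th2 mul1r.
  case: muE => muE.
    by apply: (par _ 0); rewrite ?rpred0 // rsE muE /=; ring.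
  by apply: (par _ _ thA); rewrite rsE muE /=; ring.
apply: (DE8 true).
have rsE : residue_sum N psi z 2 = (mobius N)%:~R - residue_sum N psi z 1.
  by apply: halve; rewrite rs2 mulrBr th2; ring.
case: muE => muE.
  by apply: (par _ (- residue_sum N psi z 1)); rewrite ?rpredN // rsE muE /=; ring.
by apply: (par _ (-1)); rewrite ?rpredN ?rpred1 // rsE muE /=; ring.
Qed.

End Reciprocity.

(** * The Kronecker symbol as a primitive character *)

Lemma mobius_sqfree (n : nat) :
    (0 < n)%N -> (forall p, prime p -> ~~ (p ^ 2 %| n)%N) ->
  mobius n ^+ 2 = 1.
Proof.
move=> n_gt0 n_sf; rewrite /mobius n_gt0; case: allP => [_|[]].
  by rewrite sqrr_sign.
move=> p pn; have := pn; rewrite mem_primes => /and3P[p_pr _ pdn].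
have := n_sf p p_pr; rewrite pfactor_dvdn // -ltnNge ltnS => le1.
by rewrite eqn_leq le1 /= -pfactor_dvdn.
Qed.

Section KroneckerSymbol.

Variables (N : nat) (psi : int -> int).
Hypothesis psiP : real_primitive_char N psi.
Hypothesis N_gt1 : (1 < N)%N.
Hypothesis N_sqfree : odd N -> mobius N ^+ 2 = 1.
Let Delta := psi (-1) * N%:Z.

Lemma kronecker_prime_charE (p : nat) : prime p -> kronecker_prime Delta p = psi p.
Proof.
move=> p_pr; rewrite /kronecker_prime; case: eqP => [->|/eqP p2].
  have [N_odd|N_even] := boolP (odd N).
    exact: (rpc_sqfree_kronecker2 psiP (N_sqfree N_odd) N_odd).
  have N2 : (2 %| N%:Z)%Z by rewrite dvdzE /= dvdn2.
  rewrite /kronecker2 dvdz_mull // (rpc0 psiP) //.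
  by rewrite coprimez_sym (coprimez_prime (isT : prime 2)) negbK.
by apply: (rpc_odd_prime psiP p_pr); case: (even_prime p_pr) => // e; rewrite e in p2.
Qed.

Lemma char_prod_primes (n : nat) : (0 < n)%N ->
  psi n = \prod_(p <- primes n) psi p ^+ logn p n.
Proof.
move=> n_gt0; have psi1 := rpc1 psiP.
have psiX (a k : nat) : psi (a ^ k)%N = psi a ^+ k.
  by elim: k => [|k IH]; rewrite ?psi1 // expnS PoszM (rpcM psiP) IH exprS.
rewrite {1}(prod_prime_decomp n_gt0) prime_decompE big_map /=.
apply: (big_rec2 (fun (x : nat) y => psi x = y)) => // p y1 y2 _ <-.
by rewrite PoszM (rpcM psiP) psiX.
Qed.

Lemma kronecker_charE (a : int) : kronecker Delta a = psi a.
Proof.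
have absD : `|Delta|%N = N.
  by rewrite /Delta abszM; case: (rpcN1 psiP) => ->; rewrite mul1n.
(* At [a = 0] both sides vanish because [N > 1]. *)
rewrite /kronecker; case: eqP => [->|/eqP a0].
  by rewrite absD gtn_eqF // (rpc0 psiP) // /coprimez /gcdz gcd0n eqz_nat gtn_eqF.
have abs_gt0 : (0 < `|a|)%N by rewrite absz_gt0.
under eq_big_seq => p do
  [rewrite mem_primes => /and3P[p_pr _ _]; rewrite kronecker_prime_charE //].
rewrite -char_prod_primes //.
(* The sign convention of the Kronecker symbol for negative [a] is thus the value [psi (-1)]. *)
have DE : (Delta < 0) = (psi (-1) == -1).
  rewrite /Delta; case: (rpcN1 psiP) => ->; rewrite ?mul1r ?mulN1r ?oppr_lt0 ltz_nat //.
  by rewrite ltnW.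
rewrite DE {3}(intEsg a) (rpcM psiP); congr (_ * _).
case: sgzP a0 => //= _ _; first by rewrite (rpc1 psiP).
by case: (rpcN1 psiP) => ->.
Qed.

End KroneckerSymbol.

Lemma squarefreez_nat (m : int) (p : nat) :
  squarefreez m -> prime p -> ~~ (p ^ 2 %| `|m|)%N.
Proof.
move=> m_sf p_pr; apply/negP => dvd.
have /m_sf : ((p : int) ^+ 2 %| m)%Z by rewrite dvdzE abszX.
by rewrite qualifE /= => /orP[]; rewrite ?eqz_nat // => /eqP e; rewrite e in p_pr.
Qed.

(** The odd part of [m] determines a product of Legendre symbols; the factor at 2 (none, [chi4],
    [chi8] or [chiN8]) is then chosen to give the right conductor and sign. *)
Lemma quad_disc_char (m : int) : squarefreez m -> m <> 1 ->
  exists N psi, [/\ real_primitive_char N psi, (1 < N)%N,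
    odd N -> mobius N ^+ 2 = 1 & quad_disc m = psi (-1) * N%:Z].
Proof.
move=> m_sf m_neq1.
have n_sf p : prime p -> ~~ (p ^ 2 %| `|m|)%N by apply: squarefreez_nat.
have m4 : (m %% 4)%Z <> 0.
  by move=> /dvdz_mod0P; rewrite dvdzE; apply/negP/(n_sf 2).
have [n_odd|n_even] := boolP (odd `|m|).
  have n_gt0 : (0 < `|m|)%N by case: `|m|%N n_odd.
  have [psi psiP] := odd_real_primitive_char n_odd n_sf.
  have psiN1 := rpcN1 psiP.
  have mob := mobius_sqfree n_gt0 n_sf.
  (* This says which of [m] and [-m] equals [psi (-1) * |m|]: the one congruent to 1 modulo 4. In
     the other case [chi4] flips the sign. *)
  have D4 := rpc_sqfree_mod4 psiP mob.
  have [m1|m1] := eqVneq (m %% 4)%Z 1.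
    exists `|m|%N, psi; split=> //; first by lia.
    rewrite /quad_disc m1 eqxx.
    by case: psiN1 D4 => ->; lia.
  exists (4 * `|m|)%N, (fun a => chi4 a * psi a); split.
  - apply: real_primitive_charM => //; first exact: chi4_char.
    by rewrite (@coprimeXl 2 2) // coprime2n.
  - by lia.
  - by rewrite oddM.
  rewrite /quad_disc (negPf m1) -[chi4 (-1)]/(-1).
  by case: psiN1 D4 => ->; lia.
have [n nE] : exists n, `|m|%N = (2 * n)%N.
  by exists `|m|./2; rewrite mul2n -[LHS]odd_double_half (negPf n_even).
have n_sf' p : prime p -> ~~ (p ^ 2 %| n)%N.
  by move/n_sf; apply: contra; rewrite nE; apply: dvdn_mull.
have n_odd : odd n by lia.
have n_gt0 : (0 < n)%N by case: (n) n_odd.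
have [psi psiP] := odd_real_primitive_char n_odd n_sf'.
have psiN1 := rpcN1 psiP.
have co : coprime 8 n by rewrite (@coprimeXl 3 2) // coprime2n.
have -> : quad_disc m = 4 * m.
  by rewrite /quad_disc; case: eqP => //; lia.
(* The left side is [m] or [-m]; the even [chi8] keeps the sign, the odd [chiN8] reverses it. *)
have [pm|pm] := eqVneq (2 * (psi (-1) * n%:Z)) m.
  exists (8 * n)%N, (fun a => chi8 a * psi a); split; [|by lia|by rewrite oddM|].
    by apply: real_primitive_charM => //; apply: chi8_char.
  by rewrite -[chi8 (-1)]/1; lia.
exists (8 * n)%N, (fun a => chiN8 a * psi a); split; [|by lia|by rewrite oddM|].
  by apply: real_primitive_charM => //; apply: chiN8_char.
by rewrite -[chiN8 (-1)]/(-1); case: psiN1 pm => ->; lia.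
Qed.

(** * Circulant matrices *)

(** In characteristic 0 the split polynomial ['X^n - 1] is separable, so it has [n] distinct
    roots. *)
Lemma closed_prim_root_exists (C : numClosedFieldType) (n : nat) :
  (0 < n)%N -> exists z : C, n.-primitive_root z.
Proof.
move=> n_gt0; pose p : {poly C} := 'X^n - 1.
have [rs /= pE] := closed_field_poly_normal p.
rewrite (monicP (monicXnsubC 1 n_gt0)) scale1r in pE.
have /hasP[z _ z_prim] : has n.-primitive_root rs; last by exists z.
apply: has_prim_root => //.
- apply/allP=> z z_rs; rewrite unity_rootE -subr_eq0.
  have : root p z by rewrite pE root_prod_XsubC.
  by rewrite /root /p !hornerE.
- by rewrite -separable_prod_XsubC -pE separable_Xn_sub_1 // pnatr_eq0 -lt0n.
by rewrite -ltnS -(size_prod_XsubC rs id) -pE size_XnsubC.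
Qed.

(** Multiply both sides by [\det P] and cancel it in the polynomial ring; no inverse of [P] is
    formed. *)
Lemma char_poly_conj_diag (F : fieldType) (n : nat) (A P : 'M[F]_n) (d : 'rV[F]_n) :
    \det P != 0 -> A *m P = P *m diag_mx d ->
  char_poly A = \prod_(i < n) ('X - (d 0 i)%:P).
Proof.
move=> P0 AP; have dE : char_poly (diag_mx d) = \prod_(i < n) ('X - (d 0 i)%:P).
  rewrite char_poly_trig ?diag_mx_is_trig //.
  by apply: eq_bigr => i _; rewrite mxE eqxx mulr1n.
have detP0 : \det (map_mx polyC P) != 0 by rewrite det_map_mx polyC_eq0.
rewrite -dE; apply: (mulIf detP0).
rewrite /char_poly -det_mulmx mulrC -det_mulmx; congr (\det _).
rewrite /char_poly_mx mulmxBl mulmxBr -!map_mxM AP.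
by rewrite scalar_mxC.
Qed.

Lemma spectrumE (C : numClosedFieldType) (n : nat) (A : 'M[C]_n) (s : seq C) :
  char_poly A = \prod_(x <- s) ('X - x%:P) -> spectrum A = seq_mset s.
Proof.
move=> charE; rewrite /spectrum; apply/eq_seq_msetP.
case: closed_field_poly_normal => /= r; rewrite (monicP (char_poly_monic A)) scale1r.
by rewrite charE => /esym/prod_XsubC_eq.
Qed.

Lemma spectrum_circulant (C : numClosedFieldType) (N : nat) (h : int -> C)
    (A : 'M[C]_N) (z : C) :
    N.-primitive_root z -> (forall a b, (a = b %[mod N])%Z -> h a = h b) ->
    (forall u v, A u v = h (v%:Z - u%:Z)) ->
  spectrum A = seq_mset [seq \sum_(a < N) h a * z ^ (k%:Z * a%:Z) | k : 'I_N].
Proof.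
move=> z_prim h_mod AE; have N_gt0 := prim_order_gt0 z_prim.
have z0 := prim_root_neq0 z_prim.
pose d := \row_(k < N) \sum_(a < N) h a * z ^ (k%:Z * a%:Z).
pose w := \row_(k < N) (z ^+ k).
(* The columns of this Vandermonde matrix are the Fourier vectors, independent because the powers
   [z ^+ k] are distinct. *)
have detW : \det (Vandermonde N w) != 0.
  rewrite det_Vandermonde; apply/prodf_neq0 => i _; apply/prodf_neq0 => j ij.
  rewrite !mxE subr_eq0 (eq_prim_root_expr z_prim) !modn_small //.
  by rewrite gtn_eqF.
rewrite (@spectrumE _ _ _ [seq d 0 k | k : 'I_N]); last first.
  rewrite big_map big_enum; apply: char_poly_conj_diag detW _.
  apply/matrixP=> u k; rewrite mul_mx_diag !mxE mulr_sumr.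
  pose f (b : int) := h (b - u%:Z) * z ^ (k%:Z * b).
  have powE (b : nat) : (z ^+ k) ^+ b = z ^ (k%:Z * b%:Z).
    by rewrite -exprz_exp.
  transitivity (\sum_(b < N) f b).
    by apply: eq_bigr => v _; rewrite !mxE AE powE.
  (* Translating the summation index by [u] brings out the factor [z ^ (k * u)], the entry of the
     eigenvector. *)
  rewrite -(@sum_mod_reindex _ N_gt0 _ f (fun a => f (a + u%:Z)) (+%R^~ u%:Z)) //.
  - apply: eq_bigr => a _; rewrite /f addrK powE mulrDr expfzDr //.
    by rewrite mulrA mulrC.
  - move=> a b ab; rewrite /f (h_mod (a - u%:Z) (b - u%:Z)); last first.
      by rewrite -modzDml ab modzDml.
    by congr (_ * _); apply: (expz_prim_mod z_prim); rewrite -modzMmr ab modzMmr.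
  move=> a b /eqP; rewrite eqz_mod_dvd opprD addrACA subrr addr0.
  by rewrite -eqz_mod_dvd => /eqP.
by congr seq_mset; apply: eq_image => // k; rewrite mxE.
Qed.

(** * The spectrum *)

(** With [g = D / d], the condition says [gcdn k D = g], that is, [k = j * g] with [j < d] prime to
    [d]. *)
Lemma count_gcd (D d : nat) : (d %| D)%N -> (0 < D)%N ->
  (\sum_(k < D) (D %/ gcdn k D == d))%N = totient d.
Proof.
case/dvdnP=> g ->; rewrite muln_gt0 => /andP[g_gt0 d_gt0].
rewrite mulnC (sum_ord_blocks _ _ (fun k => (d * g %/ gcdn k (d * g) == d)%N : nat)).
rewrite totient_count_coprime big_mkord; apply: eq_bigr => j _.
have gcdE k : (d * g %/ gcdn k (d * g) == d)%N = (gcdn k (d * g) == g)%N.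
  have e_dvd := dvdn_gcdr k (d * g); have e_gt0 : (0 < gcdn k (d * g))%N.
    by rewrite gcdn_gt0 muln_gt0 d_gt0 g_gt0 orbT.
  by rewrite [LHS]eq_sym eqn_div // eqn_pmul2l.
rewrite (bigD1 (Ordinal g_gt0)) //= big1 => [|b b0]; last first.
  rewrite gcdE; case: eqP => // e.
  have : (g %| j * g + b)%N by rewrite -{1}e dvdn_gcdl.
  rewrite dvdn_addr ?dvdn_mull // gtnNdvd // lt0n.
  by apply: contra b0 => /eqP b0; apply/eqP/val_inj.
rewrite addn0 addr0 gcdE -muln_gcdl -{2}[g]mul1n eqn_pmul2r //.
by rewrite /coprime gcdnC.
Qed.

Lemma sum_rpc_values (N : nat) (psi : int -> int) (e : int) :
    real_primitive_char N psi -> (1 < N)%N -> e = 1 \/ e = -1 ->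
  (\sum_(k < N) (psi k == e))%N = (totient N %/ 2)%N.
Proof.
move=> psiP N_gt1 e_sign; have N_gt0 := rpc_gt0 psiP.
(* Primitivity at frequency 0, which is not prime to [N > 1], shows that [psi] takes the value -1;
   multiplication by [c] then exchanges the two fibres. *)
have [c c1 _] : exists2 c, psi c = -1 & (c * 0 = 0 %[mod N])%Z.
  apply: (rpc_prim psiP); rewrite /coprimez /gcdz gcd0n eqz_nat gtn_eqF //.
have co_c : coprimez c N by apply: (rpc_coprime_neq0 psiP); rewrite c1.
have eq_pm : (\sum_(k < N) (psi k == 1%R) = \sum_(k < N) (psi k == (-1)%R))%N.
  rewrite -(@sum_mod_reindex _ N_gt0 _ (fun a => (psi a == -1) : nat)
    (fun a => (psi a == 1) : nat) ( *%R c)) //.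
  - by move=> a b ab; rewrite (rpc_mod psiP ab).
  - by move=> a b; apply: coprimez_mulIm.
  by move=> a; rewrite (rpcM psiP) c1 mulN1r eqr_opp.
have tot : (totient N = \sum_(k < N) (psi k == 1%R) + \sum_(k < N) (psi k == (-1)%R))%N.
  rewrite totient_count_coprime big_mkord -big_split; apply: eq_bigr => k _ /=.
  rewrite coprime_sym -[coprime k N]/(coprimez k N).
  by case: (rpcP psiP k).
by move: tot; case: e_sign => ->; rewrite -?eq_pm addnn -muln2 => ->; rewrite mulnK.
Qed.

Lemma sqrtz_sqr (C : numClosedFieldType) (x : int) : sqrtz C x ^+ 2 = x%:~R.
Proof.
rewrite /sqrtz; case: ifPn => [x_ge0|]; first by rewrite sqrtCK.
by rewrite -ltNge => x_lt0; rewrite exprMn sqrCi sqrtCK mulN1r ltr0_norm // intrN opprK.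
Qed.

Lemma mset_sumE (K : choiceType) (I : Type) (s : seq I) (P : pred I)
    (A : I -> {mset K}%mset) (x : K) :
  (\big[msetD/mset0]_(i <- s | P i) A i)%mset x = (\sum_(i <- s | P i) A i x)%N.
Proof.
by apply: (big_morph (fun B : {mset K}%mset => B x)) => [B1 B2|]; rewrite ?msetE2 ?mset0E.
Qed.

Section PaleySpectrum.

Variables (C : numClosedFieldType) (N : nat) (psi : int -> int).
Hypothesis psiP : real_primitive_char N psi.
Hypothesis N_gt1 : (1 < N)%N.
Let N_gt0 := rpc_gt0 psiP.

Lemma residue_sum_eigenvalue (z : C) (k : nat) : N.-primitive_root z ->
  let d := (N %/ gcdn k N)%N in
  residue_sum N psi z k = 1 / 2 * ((psi k)%:~R * gauss_sum N psi z 1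
    + (totient N)%:R / (totient d)%:R * (mobius d)%:~R).
Proof.
move=> z_prim d; have d_prim := exp_prim_root z_prim k.
rewrite -(ramanujan_sumE N_gt0 d_prim).
  by rewrite -[z ^+ k]/(z ^ k) -(residue_sumE _ psiP z_prim) mul1r mulKf ?pnatr_eq0.
by apply/dvdnP; exists (gcdn k N); rewrite mulnC divnK // dvdn_gcdr.
Qed.

Lemma paley_mset (z g : C) : N.-primitive_root z ->
    g ^+ 2 = (psi (-1) * N%:Z)%:~R ->
  seq_mset [seq residue_sum N psi z k%:Z | k : 'I_N] =
    ((\big[msetD/mset0]_(d <- divisors N | (d < N)%N)
        msetn (totient d)
          (1 / 2 * ((totient N)%:R / (totient d)%:R) * (mobius d)%:~R))
    `+` msetn (totient N %/ 2)%N (1 / 2 * (g + (mobius N)%:~R))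
    `+` msetn (totient N %/ 2)%N (1 / 2 * (- g + (mobius N)%:~R)))%mset.
Proof.
move=> z_prim g2; apply/msetP => x.
pose ev (d : nat) : C := 1 / 2 * ((totient N)%:R / (totient d)%:R) * (mobius d)%:~R.
pose evG (e : int) : C := 1 / 2 * (e%:~R * gauss_sum N psi z 1 + (mobius N)%:~R).
transitivity (\sum_(d <- divisors N | (d < N)%N) totient d * (x == ev d) +
   totient N %/ 2 * (x == evG 1%R) + totient N %/ 2 * (x == evG (-1)%R))%N; last first.
  have msetnM n (y : C) : msetn n y x = (n * (x == y))%N.
    by rewrite msetnE; case: eqP; rewrite ?muln1 ?muln0.
  rewrite !msetE2 !msetnM mset_sumE; under [in RHS]eq_bigr do rewrite msetnM.
  (* The two possible signs merely swap the last two multisets, which have equal size. *)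
  have : g = gauss_sum N psi z 1 \/ g = - gauss_sum N psi z 1.
    move/eqP: g2; rewrite -(gauss_sum_sqr psiP z_prim) eqf_sqr.
    by case/orP=> /eqP; [left | right].
  have -> : evG 1 = 1 / 2 * (gauss_sum N psi z 1 + (mobius N)%:~R).
    by rewrite /evG !mul1r.
  have -> : evG (-1) = 1 / 2 * (- gauss_sum N psi z 1 + (mobius N)%:~R).
    by rewrite /evG rmorphN1 mulN1r.
  rewrite -!addnA => gE; congr addn.
  by case: gE => ->; rewrite ?opprK //; apply: addnC.
rewrite mset_seqE count_map -sum1_count big_enum_cond /=.
rewrite big_mkcond /=.
(* Each frequency [k] feeds exactly one term: that of [d = N / gcdn k N] if [d < N], or else, [k]
   being prime to [N], the one selected by the sign [psi k]. *)
transitivity (\sum_(k < N) (\sum_(d <- divisors N | (d < N)%N)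
      (N %/ gcdn k N == d) * (x == ev d) +
    (psi k == 1%R) * (x == evG 1%R) + (psi k == (-1)%R) * (x == evG (-1)%R)))%N.
  apply: eq_bigr => k _.
  have -> : (if residue_sum N psi z k == x then 1 else 0)%N = (x == residue_sum N psi z k).
    by rewrite eq_sym; case: eqP.
  rewrite (residue_sum_eigenvalue k z_prim).
  have d_dvd : (N %/ gcdn k N \in divisors N)%N.
    rewrite -dvdn_divisors //; apply/dvdnP; exists (gcdn k N).
    by rewrite mulnC divnK // dvdn_gcdr.
  have gcd_gt0 : (0 < gcdn k N)%N by rewrite gcdn_gt0 N_gt0 orbT.
  have coE : if coprimez k N then (N %/ gcdn k N = N)%N else (N %/ gcdn k N < N)%N.
    rewrite -[coprimez k N]/(coprime k N) /coprime; case: eqP => [->|/eqP ne1].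
      by rewrite divn1.
    by rewrite ltn_Pdiv // ltn_neqAle eq_sym ne1.
  have sum0 : (N %/ gcdn k N = N)%N ->
      (\sum_(d <- divisors N | (d < N)%N) (N %/ gcdn k N == d) * (x == ev d) = 0)%N.
    move=> dE; rewrite big1 // => d d_lt.
    by rewrite dE gtn_eqF // mul0n.
  have tot_neq0 : (totient N)%:R != 0 :> C by rewrite pnatr_eq0 -lt0n totient_gt0.
  case: (rpcP psiP k) coE => /= psik coE.
  - by rewrite sum0 // coE divff // [1 * (mobius N)%:~R]mul1r mul1n mul0n addn0.
  - by rewrite sum0 // coE divff // [1 * (mobius N)%:~R]mul1r mul1n mul0n.
  rewrite mul0r add0r mulrA !mul0n !addn0 big_mkcond.
  rewrite (bigD1_seq _ d_dvd (divisors_uniq N)) /= coE eqxx mul1n big1 ?addn0 //.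
  by move=> d; rewrite eq_sym => /negPf ->; rewrite mul0n if_same.
(* Summing over [k] first turns the indicators into the multiplicities. *)
rewrite !big_split /= exchange_big /= -!big_distrl /=.
rewrite !(sum_rpc_values psiP) //; [|by right|by left].
congr (_ + _ + _)%N; rewrite big_seq_cond [RHS]big_seq_cond.
apply: eq_bigr => d /andP[]; rewrite -dvdn_divisors // => dN _.
by rewrite -big_distrl /= count_gcd.
Qed.

End PaleySpectrum.

Local Open Scope mset_scope.

Theorem theorem3p5 (C : numClosedFieldType) (m : int)
    (m_sqfree : squarefreez m) (m_neq1 : m <> 1) :
  let Delta := quad_disc m in
  let D := `|Delta|%N in
  spectrum (adjmx C (@paley Delta)) =
    (\big[msetD/mset0]_(d <- divisors D | (d < D)%N)
        msetn (totient d)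
          (1 / 2 * ((totient D)%:R / (totient d)%:R) * (mobius d)%:~R))
    `+` msetn (totient D %/ 2)%N (1 / 2 * (sqrtz C Delta + (mobius D)%:~R))
    `+` msetn (totient D %/ 2)%N (1 / 2 * (- sqrtz C Delta + (mobius D)%:~R)).
Proof.
have [N [psi [psiP N_gt1 N_sqfree DE]]] := quad_disc_char m_sqfree m_neq1.
move=> Delta; rewrite -/Delta in DE.
have NE : N = `|Delta|%N.
  by rewrite DE abszM; case: (rpcN1 psiP) => ->; rewrite mul1n.
subst N => D.
have [z z_prim] := closed_prim_root_exists C (rpc_gt0 psiP).
(* [sqrtz C Delta] enters only through its square, which is that of the Gauss sum. *)
rewrite -(paley_mset psiP N_gt1 z_prim); last by rewrite sqrtz_sqr -DE.
apply: (spectrum_circulant (h := fun a => (psi a == 1)%:R)) => // [a b ab|u v].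
  by rewrite (rpc_mod psiP ab).
rewrite mxE /paley -(kronecker_charE psiP N_gt1 N_sqfree).
by rewrite -DE.
Qed.
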